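(* Let $G$ be a prime tournament which is not isomorphic to $T_n$, $U_n$, or $W_n$ for any odd $n$, and let $H$ be a prime subtournament of $G$ with $5 \le |V(H)| \le |V(G)| - 1$. Then there exists a prime subtournament of $G$ with $|V(H)|+1$ vertices that has a subtournament isomorphic to $H$.
   Context: A tournament is a finite, non-null, loopless directed graph in which for any two distinct vertices $u,v$ there is exactly one edge with both ends in $\{u,v\}$; write $u \to v$ if the edge goes from $u$ to $v$. A subtournament is the tournament induced on a nonempty subset of vertices. For disjoint vertex sets $X,Y$, $X \Rightarrow Y$ means $x \to y$ for all $x\in X$, $y \in Y$. A homogeneous set of a tournament $G$ is a set $X \subseteq V(G)$ such that for every $v \in V(G)\setminus X$, either $v \to x$ for all $x \in X$ or $x \to v$ for all $x\in X$; it is nontrivial if $1<|X|<|V(G)|$. A tournament is prime if all its homogeneous sets are trivial. For $k \ge 0$ and $n=2k+1$: $T_n$ is the tournament on $v_1,\dots,v_n$ with $v_i \to v_j$ iff $j \equiv i+1, i+2,\dots, i+k \pmod n$; $U_n$ is obtained from $T_n$ by reversing all edges with both ends in $\{v_1,\dots,v_k\}$; $W_n$ is the tournament on $w_1,\dots,w_n$ with $w_i \to w_j$ for $1 \le i<j\le n-1$ and $\{w_2,w_4,\dots,w_{n-1}\} \Rightarrow w_n \Rightarrow \{w_1,w_3,\dots,w_{n-2}\}$. *)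

(* Defs.v *)
From mathcomp Require Import all_boot.
Set Implicit Arguments. Unset Strict Implicit. Unset Printing Implicit Defensive.

Definition is_tournament (T : finType) (e : rel T) : Prop :=
  0 < #|T| /\ (forall u, ~~ e u u) /\
  (forall u v, u != v -> (e u v && ~~ e v u) || (e v u && ~~ e u v)).

Definition homogeneous (T : finType) (e : rel T) (S X : {set T}) : Prop :=
  X \subset S /\
  forall v, v \in S :\: X ->
    (forall x, x \in X -> e v x) \/ (forall x, x \in X -> e x v).

Definition prime_on (T : finType) (e : rel T) (S : {set T}) : Prop :=
  forall X : {set T}, homogeneous e S X -> ~ (1 < #|X| /\ #|X| < #|S|).

Definition tiso (T : finType) (e : rel T) (n : nat) (r : rel 'I_n) : Prop :=
  exists f : T -> 'I_n, bijective f /\ forall u v, e u v = r (f u) (f v).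

Definition sub_iso (T : finType) (e : rel T) (A B : {set T}) : Prop :=
  exists f : T -> T, {in A &, injective f} /\ f @: A = B /\
    {in A &, forall u v, e u v = e (f u) (f v)}.

(* Vertices v_1..v_n are represented by 0..n-1 (v_{i+1} ~ i). *)
(* T_n : v_i -> v_j iff j = i+1,...,i+k (mod n), with k = n./2 *)
Definition Tn_rel (n : nat) : rel 'I_n :=
  fun i j => (0 < (j + n - i) %% n) && ((j + n - i) %% n <= n./2).

Definition Un_rel (n : nat) : rel 'I_n :=
  fun i j => if (i < n./2) && (j < n./2) then Tn_rel j i else Tn_rel i j.

(* W_n : w_i -> w_j for i<j<=n-1, and
   {w_2,w_4,...,w_{n-1}} => w_n => {w_1,w_3,...,w_{n-2}} *)
Definition Wn_rel (n : nat) : rel 'I_n :=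
  fun i j =>
    if (i < n.-1) && (j < n.-1) then i < j
    else if j == n.-1 :> nat then (i < n.-1) && odd i
    else (i == n.-1 :> nat) && (j < n.-1) && ~~ odd j.

(* Main.v *)
(* Suppose no copy of C extends to a prime subtournament by one vertex (C is
   "rigid"). Since G is prime, some C + x + y = D is prime (Ehrenfeucht and
   Rozenberg). Join p and q in D when D - p - q is a copy of C. Rigidity makes
   every degree in the component of {x, y} at most 2, and the two neighbours of
   p are twins in D - p; so the component is a path or a cycle, and the twin
   relations force D to be T_n, U_n or W_n. Such a D is rigid in turn: the
   adjacencies of a new vertex v along the path form a word, and if v does not
   extend D to a prime tournament with two consecutive vertices deleted, wherever
   these lie, then v is constant or a twin on D. Starting from H, iterating this
   step exhausts G. *)

Require Import Defs.
From mathcomp Require Import all_boot zify.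
From Stdlib Require Import Classical.
Set Implicit Arguments. Unset Strict Implicit. Unset Printing Implicit Defensive.

(** Rigidity concerns every copy of C in G, not C alone: exchanging twins and deleting pairs from D
    produce other copies. The two neighbours of a path vertex look alike to every other vertex off
    the pair, so a position can be slid by two along the path. Hence only parities matter, and few
    cases remain: a closed path gives T_n, an open one gives U_n or W_n according to the parity of
    its length. Deleting two consecutive positions keeps all parities, so D minus such a pair is
    again laid out in the same way, and rules that read only a parity and two adjacent letters can
    be compared before and after the deletion. This comparison needs seven letters in types T and U;
    |C| >= 5 supplies them, since |D| = |C| + 2. *)

(** * Words along a path and their local rules *)

Inductive crit_type := FamT | FamU | FamW.

(* Along the path of a critical tournament, the direction of the edge between
   positions i < j depends only on the parities of i and j. *)
Definition forward (F : crit_type) (a b : bool) : bool :=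
  match F with FamT => a (+) b | FamU => a || b | FamW => true end.

(* A word f records the adjacencies of a vertex along the path. A rule is applied
   to (parity of i, f i, f i.+1); the twisted ones apply to f i (+) odd i, which is
   monotone for the row of any vertex of T_n and for the rows of the even positions
   of U_n. *)
Definition local_rule := bool -> bool -> bool -> bool.

Definition rising : local_rule := fun _ a b => a ==> b.
Definition twisted_rising : local_rule := fun o a b => (a (+) o) ==> (b (+) ~~ o).
Definition twisted_falling : local_rule := fun o a b => (b (+) ~~ o) ==> (a (+) o).
Definition steady : local_rule := fun _ a b => a == b.
Definition twisted_full : local_rule := fun o a b => (a (+) o) && (b (+) ~~ o).

(** The lists are chosen so that the tame words are those of constant vertices and of twins, as
    [crit_tame] and [tame_extension] establish. Type T separates rows of odd positions, rows of even
    positions and constants; in type W the last rule is for a twin of the extra vertex. *)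
Definition rules (F : crit_type) : seq local_rule :=
  match F with
  | FamT => [:: twisted_rising; twisted_falling; steady]
  | FamU => [:: rising; twisted_falling]
  | FamW => [:: rising; twisted_full]
  end.

Definition obeys (r : local_rule) (n : nat) (f : nat -> bool) : bool :=
  all (fun i => r (odd i) (f i) (f i.+1)) (iota 0 n.-1).

Definition tame (F : crit_type) (n : nat) (f : nat -> bool) : bool :=
  has (fun r => obeys r n f) (rules F).

Definition skip (k i : nat) : nat := if i < k then i else i.+2.

Lemma odd_skip k i : odd (skip k i) = odd i.
Proof. by rewrite /skip; case: ifP => //=; rewrite negbK. Qed.

Lemma obeysP (r : local_rule) n f :
  reflect (forall i, i.+1 < n -> r (odd i) (f i) (f i.+1)) (obeys r n f).
Proof.
apply: (iffP allP) => H i; last by rewrite mem_iota => Hi; apply: H; lia.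
by move=> Hi; apply: H; rewrite mem_iota; lia.
Qed.

Lemma obeysPn (r : local_rule) n f :
  ~~ obeys r n f -> exists2 i, i.+1 < n & ~~ r (odd i) (f i) (f i.+1).
Proof.
rewrite -has_predC => /hasP [i]; rewrite mem_iota /= => Hi Hr.
by exists i => //; lia.
Qed.

(** If the failing pair lies wholly on one side of the deleted pair, its letters stay adjacent and
    are shifted by 0 or 2, so the rule still sees the same parity. *)
Lemma obeys_skip (r : local_rule) n f k i :
  i.+1 < n -> ~~ r (odd i) (f i) (f i.+1) -> (i.+1 < k) || (k.+1 < i) ->
  k.+1 < n -> ~~ obeys r n.-2 (f \o skip k).
Proof.
move=> Hi Hr Hk Hkn; apply/negP => /obeysP H; move/negP: Hr; apply.
case/orP: Hk => Hk.
- have := H i; rewrite /= /skip; have -> : i < k by lia.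
  by rewrite Hk; apply; lia.
- have := H i.-2; rewrite /= /skip; have -> : (i.-2 < k) = false by lia.
  have -> : (i.-2.+1 < k) = false by lia.
  have -> : i.-2.+2 = i by lia.
  have -> : odd i.-2 = odd i by lia.
  by apply; lia.
Qed.

(* Each i rules out at most one of 0, 3, 6, 9. *)
Lemma avoid_three i1 i2 i3 : exists2 k, k < 10 &
  [&& (i1.+1 < k) || (k.+1 < i1), (i2.+1 < k) || (k.+1 < i2)
    & (i3.+1 < k) || (k.+1 < i3)].
Proof.
have : has (fun k => [&& (i1.+1 < k) || (k.+1 < i1), (i2.+1 < k) || (k.+1 < i2)
    & (i3.+1 < k) || (k.+1 < i3)]) [:: 0; 3; 6; 9].
  by rewrite /=; lia.
by case/hasP=> k Hk H; exists k => //; move: Hk; rewrite !inE; lia.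
Qed.

(** One failing pair per rule witnesses wildness, and there are at most three rules; it is enough to
    delete away from these witnesses. The bound on n makes room for any k < 10 given by
    [avoid_three]. *)
Lemma wild_skip_large F n f : 10 < n -> ~~ tame F n f ->
  exists2 k, k.+1 < n & ~~ tame F n.-2 (f \o skip k).
Proof.
move=> Hn Hf.
have [i1 [i2 [i3 H]]] : exists i1 i2 i3, forall k, k.+1 < n ->
    [&& (i1.+1 < k) || (k.+1 < i1), (i2.+1 < k) || (k.+1 < i2)
    & (i3.+1 < k) || (k.+1 < i3)] -> ~~ tame F n.-2 (f \o skip k).
  case: F Hf; rewrite /tame /= ?orbF ?negb_or.
  - case/and3P => /obeysPn [i1 H1 R1] /obeysPn [i2 H2 R2] /obeysPn [i3 H3 R3].
    exists i1, i2, i3 => k Hk /and3P [K1 K2 K3].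
    rewrite ?orbF !negb_or; apply/and3P; split.
    + exact: (obeys_skip H1).
    + exact: (obeys_skip H2).
    + exact: (obeys_skip H3).
  - case/andP => /obeysPn [i1 H1 R1] /obeysPn [i2 H2 R2].
    (* Only two rules here, so the second witness is repeated. *)
    exists i1, i2, i2 => k Hk /and3P [K1 K2 K3].
    rewrite ?orbF !negb_or; apply/andP; split.
    + exact: (obeys_skip H1).
    + exact: (obeys_skip H2).
  - case/andP => /obeysPn [i1 H1 R1] /obeysPn [i2 H2 R2].
    exists i1, i2, i2 => k Hk /and3P [K1 K2 K3].
    rewrite ?orbF !negb_or; apply/andP; split.
    + exact: (obeys_skip H1).
    + exact: (obeys_skip H2).
have [k Hk K] := avoid_three i1 i2 i3.
by exists k; [lia | apply: H => //; lia].
Qed.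

Fixpoint words (n : nat) : seq (seq bool) :=
  if n is m.+1 then
    [seq true :: w | w <- words m] ++ [seq false :: w | w <- words m]
  else [:: [::]].

Lemma mem_words w : w \in words (size w).
Proof.
by elim: w => //= -[] w IH; rewrite mem_cat map_f ?orbT.
Qed.

Lemma eq_tame F n f g : (forall i, i < n -> f i = g i) -> tame F n f = tame F n g.
Proof.
move=> H; apply: eq_has => r; apply: eq_in_all => i.
by rewrite mem_iota => Hi; rewrite !H //; lia.
Qed.

Lemma skip_lt k n i : k.+1 < n -> i < n.-2 -> skip k i < n.
Proof. by rewrite /skip; case: ifP; lia. Qed.

(** Boolean, so that the short lengths can be settled by evaluation over all words. *)
Definition wild_skips F n := all (fun w : seq bool =>
  tame F n (nth false w) ||
    has (fun k => ~~ tame F n.-2 (nth false w \o skip k)) (iota 0 n.-1)) (words n).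

Lemma wild_skip_small F n f : wild_skips F n -> ~~ tame F n f ->
  exists2 k, k.+1 < n & ~~ tame F n.-2 (f \o skip k).
Proof.
move=> /allP W Hf.
have := mem_words (mkseq f n); rewrite size_mkseq => /W.
have E i : i < n -> nth false (mkseq f n) i = f i by move=> Hi; rewrite nth_mkseq.
rewrite (eq_tame _ E) (negbTE Hf) /=.
case/hasP => k; rewrite mem_iota => Hk K; exists k; first lia.
rewrite -(@eq_tame _ _ (nth false (mkseq f n) \o skip k)) // => i Hi /=.
by rewrite E // skip_lt //; lia.
Qed.

(* For six letters the statement fails in types T and U. *)
Lemma wild_skip F n f : (if F is FamW then 6 else 7) <= n -> ~~ tame F n f ->
  exists2 k, k.+1 < n & ~~ tame F n.-2 (f \o skip k).
Proof.
move=> Hn; have [Hn'|] := ltnP 10 n; first exact: wild_skip_large.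
move=> Hn'; apply: wild_skip_small.
case: F Hn => Hn.
- by do 11 (case: n Hn Hn' => [|n] Hn Hn' //); vm_compute.
- by do 11 (case: n Hn Hn' => [|n] Hn Hn' //); vm_compute.
- by do 11 (case: n Hn Hn' => [|n] Hn Hn' //); vm_compute.
Qed.

(** * Homogeneous sets, twins and one-vertex extensions *)

Section Tournament.

Variables (T : finType) (e : rel T).
Hypothesis e_irr : forall u, e u u = false.
Hypothesis e_total : forall u v, u != v -> e v u = ~~ e u v.

(** An equational form of homogeneity: in a tournament the edges from z to X determine those from X
    to z. *)
Definition uniform (S X : {set T}) : Prop :=
  forall z x y, z \in S -> z \notin X -> x \in X -> y \in X -> e z x = e z y.

Lemma uniform_homogeneous (S X : {set T}) :
  X \subset S -> uniform S X -> homogeneous e S X.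
Proof.
move=> XS U; split=> // z; rewrite inE => /andP [zX zS].
have [->|[x0 x0X]] := set_0Vmem X; first by left=> x; rewrite inE.
case E: (e z x0).
- by left=> x xX; rewrite (U z x x0).
- right=> x xX; rewrite e_total; first by rewrite (U z x x0) ?E.
  by apply: contraNneq zX => ->.
Qed.

Lemma homogeneous_uniform (S X : {set T}) : homogeneous e S X -> uniform S X.
Proof.
case=> XS H z x y zS zX xX yX.
have zSX : z \in S :\: X by rewrite inE zX.
have nz w : w \in X -> w != z by move=> wX; apply: contraNneq zX => <-.
have [H1|H1] := H z zSX; first by rewrite !H1.
by rewrite (e_total (nz _ xX)) (e_total (nz _ yX)) !H1.
Qed.

Lemma prime_trivial (S X : {set T}) :
  prime_on e S -> X \subset S -> uniform S X -> 1 < #|X| -> X = S.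
Proof.
move=> P XS U X1; apply/eqP; rewrite eqEcard XS leqNgt; apply/negP => XltS.
exact: P (uniform_homogeneous XS U) (conj X1 XltS).
Qed.

Lemma not_prime (S : {set T}) : ~ prime_on e S ->
  exists X : {set T}, [/\ X \subset S, uniform S X, 1 < #|X| & X != S].
Proof.
move=> NP; have [X NX] := not_all_ex_not _ _ NP.
have [H NN] := imply_to_and _ _ NX; have [X1 XS] := NNPP _ NN.
exists X; split=> //; first by case: H.
  exact: homogeneous_uniform.
by apply: contraTneq XS => ->; rewrite ltnn.
Qed.

Lemma uniform_sub (S A X : {set T}) :
  A \subset S -> uniform S X -> uniform A (X :&: A).
Proof.
move=> /subsetP AS U z x y zA; rewrite !inE zA andbT => zX /andP [xX _] /andP [yX _].
exact: U (AS _ zA) zX xX yX.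
Qed.

Lemma prime_trace (S A X : {set T}) :
    prime_on e A -> A \subset S -> uniform S X ->
  {in X & X, forall a b, a \in A -> b \in A -> a = b} \/ A \subset X.
Proof.
move=> PA AS /(uniform_sub AS) U.
have [le1|gt1] := leqP #|X :&: A| 1.
- left=> a b aX bX aA bA.
  by apply: (card_le1_eqP le1); rewrite inE ?aX ?bX ?aA ?bA.
- by right; apply/setIidPr; apply: prime_trivial gt1 => //; exact: subsetIr.
Qed.

(** The edge between [v] and [u] is left free. *)
Definition twin (A : {set T}) (v u : T) : bool :=
  [forall x in A, (x != u) ==> (e v x == e u x)].

Lemma twinP (A : {set T}) v u :
  reflect (forall x, x \in A -> x != u -> e v x = e u x) (twin A v u).
Proof.
apply: (iffP 'forall_implyP) => H x xA.
  by move=> xu; apply/eqP; move/implyP: (H x xA); apply.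
by apply/implyP => xu; apply/eqP; exact: H.
Qed.

(** A nontrivial homogeneous set of A + v either meets A in a single vertex u, and is {u, v}, or
    contains A, and is A itself. *)
Lemma prime_extension (A : {set T}) v :
    prime_on e A -> 2 < #|A| -> v \notin A -> ~ prime_on e (v |: A) ->
  (exists b, forall x, x \in A -> e v x = b) \/ (exists2 u, u \in A & twin A v u).
Proof.
move=> PA A2 vA /not_prime [X [XS U X1 XnS]].
case: (prime_trace PA (subsetUr [set v] A) U) => [Xs|AX].
- have [a [b [aX bX ab]]] : exists a b, [/\ a \in X, b \in X & a != b].
    by case/card_gt1P: X1 => a [b [aX bX ab]]; exists a, b.
  have vX : v \in X.
    apply: contraNT ab => vX; apply/eqP; apply: Xs => //.
    + have := subsetP XS _ aX; rewrite !inE => /orP [/eqP E|//].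
      by rewrite E (negbTE vX) in aX.
    + have := subsetP XS _ bX; rewrite !inE => /orP [/eqP E|//].
      by rewrite E (negbTE vX) in bX.
  have [u [uX uv]] : exists u, u \in X /\ u != v.
    by case: (eqVneq a v) ab => [->|av] ab; [exists b | exists a]; rewrite // eq_sym.
  have uA : u \in A by have := subsetP XS _ uX; rewrite !inE (negbTE uv).
  right; exists u => //; apply/twinP => x xA xu.
  have xX : x \notin X by apply: contraNN xu => xX; apply/eqP; exact: Xs.
  have xv : x != v by apply: contraNneq vA => <-.
  rewrite (e_total xv) (e_total xu); congr (~~ _).
  by apply: U => //; rewrite !inE xA orbT.
- left; have vX : v \notin X.
    apply: contraNN XnS => vX; rewrite eqEsubset XS subUset AX andbT.
    by rewrite sub1set.
  have [a aA] : exists a, a \in A by apply/card_gt0P; lia.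
  exists (e v a) => x xA; apply: U; rewrite ?setU11 //; exact: (subsetP AX).
Qed.

(** With [twin_not_prime], the converse of [prime_extension]: the homogeneous sets are A and {u,
    v}. *)
Lemma constant_not_prime (A : {set T}) v b :
  1 < #|A| -> v \notin A -> (forall x, x \in A -> e v x = b) ->
  ~ prime_on e (v |: A).
Proof.
move=> A1 vA H P.
have E : A = v |: A.
  apply: prime_trivial A1 => //; first exact: subsetUr.
  move=> z x y; rewrite !inE => /orP [/eqP ->|-> //] _ xA yA.
  by rewrite !H.
by move: vA; rewrite E setU11.
Qed.

Lemma twin_not_prime (A : {set T}) v u :
  1 < #|A| -> v \notin A -> u \in A -> twin A v u -> ~ prime_on e (v |: A).
Proof.
move=> A1 vA uA /twinP H P.
have uv : u != v by apply: contraNneq vA => <-.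
have E : [set u; v] = v |: A.
  apply: prime_trivial P _ _ _.
  - by apply/subsetP => x; rewrite !inE => /orP [] /eqP -> ; rewrite ?uA ?eqxx ?orbT.
  - move=> z x y; rewrite !inE negb_or => /orP [/eqP ->|zA]; first by rewrite eqxx andbF.
    case/andP=> zu zv.
    have Ez : e z v = e z u by rewrite (e_total (_ : v != z)) 1?eq_sym // H // -e_total 1?eq_sym.
    by do 2 case/orP => /eqP ->; rewrite ?Ez.
  - by rewrite cards2 uv.
have : #|v |: A| = 2 by rewrite -E cards2 uv.
by rewrite cardsU1 vA; lia.
Qed.

(** * Copies of a subtournament and extensions by two vertices *)

Lemma sub_iso_card (A B : {set T}) : sub_iso e A B -> #|A| = #|B|.
Proof. by case=> f [finj [<- _]]; rewrite card_in_imset. Qed.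

Lemma sub_iso_refl (A : {set T}) : sub_iso e A A.
Proof. by exists id; split=> //; rewrite imset_id. Qed.

Lemma sub_iso_trans (A B C : {set T}) :
  sub_iso e A B -> sub_iso e B C -> sub_iso e A C.
Proof.
case=> f [fi [fE fe]] [g [gi [gE ge]]].
have fB x : x \in A -> f x \in B by move=> xA; rewrite -fE imset_f.
exists (g \o f); split; last split.
- by move=> x y xA yA /= /gi H; apply: fi => //; apply: H; exact: fB.
- by rewrite imset_comp fE.
- by move=> x y xA yA /=; rewrite fe // ge ?fB.
Qed.

Lemma sub_iso_inverse (A B : {set T}) : sub_iso e A B -> sub_iso e B A.
Proof.
case=> f [fi [fE fe]].
(* The default [y] is met only outside B. *)
pose g y := if [pick x in A | f x == y] is Some x then x else y.
have gf x : x \in A -> g (f x) = x.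
  move=> xA; rewrite /g; case: pickP => [z /andP [zA /eqP]|/(_ x)]; first exact: fi.
  by rewrite xA eqxx.
exists g; split; last split.
- by move=> y z; rewrite -fE => /imsetP [a aA ->] /imsetP [b bA ->]; rewrite !gf // => ->.
- apply/setP => x; apply/imsetP/idP => [[y]|xA].
    by rewrite -fE => /imsetP [a aA ->] ->; rewrite gf.
  by exists (f x); [rewrite -fE imset_f | rewrite gf].
- by move=> y z; rewrite -fE => /imsetP [a aA ->] /imsetP [b bA ->]; rewrite !gf // -fe.
Qed.

Lemma prime_sub_iso (A B : {set T}) :
  sub_iso e A B -> prime_on e A -> prime_on e B.
Proof.
move=> I PA X HX [X1 XB].
have [g [gi [gE ge]]] := sub_iso_inverse I.
have XsB : X \subset B by case: HX.
have gX : {in X &, injective g}.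
  by move=> x y xX yX; apply: gi; exact: (subsetP XsB).
apply: (PA (g @: X)); last by rewrite (sub_iso_card I) card_in_imset.
apply: uniform_homogeneous; first by rewrite -gE imsetS.
move/homogeneous_uniform: HX => U z x y; rewrite -gE.
move=> /imsetP [a aB ->] az /imsetP [b bX ->] /imsetP [c cX ->].
rewrite -!ge //; try exact: (subsetP XsB).
apply: U => //.
by apply: contraNN az => aX; rewrite imset_f.
Qed.

Lemma twin_exchange (A B : {set T}) u x :
    u \in A -> x \notin A -> twin A x u -> B = x |: (A :\ u) -> sub_iso e A B.
Proof.
move=> uA xA /twinP tw ->.
exists (fun y => if y == u then x else y); split; last split.
- move=> a b aA bA; case: (eqVneq a u) => [->|au]; case: (eqVneq b u) => [->|bu] //.
  + by move=> E; rewrite E bA in xA.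
  + by move=> E; rewrite -E aA in xA.
- apply/setP => y; rewrite !inE; apply/imsetP/idP => [[a aA ->]|].
    by case: (eqVneq a u) => [_|au]; rewrite ?eqxx ?au ?aA ?orbT.
  case/orP => [/eqP ->|/andP [yu yA]]; first by exists u; rewrite ?eqxx.
  by exists y; rewrite ?(negbTE yu).
- move=> a b aA bA; case: (eqVneq a u) => [->|au]; case: (eqVneq b u) => [->|bu] //.
  + by rewrite !e_irr.
  + by rewrite tw.
  + have ax : a != x by apply: contraNneq xA => <-.
    by rewrite (e_total (_ : x != a)) 1?eq_sym // tw // -e_total 1?eq_sym.
Qed.

Lemma two_others (A : {set T}) u : 2 < #|A| -> u \in A ->
  exists a b, [/\ a \in A, b \in A, a != u, b != u & a != b].
Proof.
move=> A2 uA; have : 1 < #|A :\ u| by rewrite (cardsD1 u) uA in A2; lia.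
case/card_gt1P => a [b]; rewrite !inE => -[/andP [au aA] /andP [bu bA] ab].
by exists a, b.
Qed.

(* In a homogeneous set of A + x + z, both A and its copy A - u + x leave a trivial
   trace. *)
Lemma twin_split_prime (A : {set T}) u x z :
    prime_on e A -> 2 < #|A| -> u \in A -> x \notin A -> z \notin A ->
    x != z -> twin A x u -> ~~ twin A z u -> e z x != e z u ->
  prime_on e (z |: (x |: A)).
Proof.
move=> PA A2 uA xA zA xz tx ntz zxu; apply: NNPP => /not_prime [X [XS U X1 XnS]].
have PA' : prime_on e (x |: (A :\ u)).
  by apply: prime_sub_iso PA; exact: (@twin_exchange A _ u x).
have [a [b [aA bA au bu ab]]] := two_others A2 uA.
have AS : A \subset z |: (x |: A).
  by apply/subsetP => y yA; rewrite !inE yA !orbT.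
have A'S : x |: (A :\ u) \subset z |: (x |: A).
  by apply/subsetP => y; rewrite !inE => /orP [->|/andP [_ ->]]; rewrite ?orbT.
have memS y : y \in A -> y \in z |: (x |: A) by exact: (subsetP AS).
have zS : z \in z |: (x |: A) by rewrite !inE eqxx.
have memA' y : y \in A -> y != u -> y \in x |: (A :\ u).
  by move=> yA yu; rewrite !inE yA yu orbT.
have xA' : x \in x |: (A :\ u) by rewrite !inE eqxx.
have ne (y w : T) : y \in A -> w \notin A -> y != w.
  by move=> yA; apply: contraNneq => <-.
have flip y w : y \in A -> w \notin A -> e y w = ~~ e w y.
  by move=> yA wA; rewrite e_total // eq_sym; exact: ne.
have [HA|HA] := prime_trace PA AS U; have [HA'|HA'] := prime_trace PA' A'S U; last first.
- have zX : z \notin X.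
    apply: contraNN XnS => zX; rewrite eqEsubset XS /= !subUset HA !sub1set zX.
    by rewrite (subsetP HA').
  move/eqP: zxu; apply; apply: U => //; first by rewrite (subsetP HA').
  by rewrite (subsetP HA).
- case/eqP: ab; apply: HA'; rewrite ?(subsetP HA) //; exact: memA'.
- case/eqP: ab; apply: HA; rewrite ?(subsetP HA') //; exact: memA'.
have small y w : y \in X -> w \in X -> y \in A -> w \in A -> y = w by move=> *; exact: HA.
have only_u y : y \in X -> x \in X -> y \in A -> y = u.
  move=> yX xX yA; apply: contraNeq (ne _ _ yA xA) => yu.
  by apply/eqP; apply: HA' => //; exact: memA'.
have Xcases y : y \in X -> [\/ y = z, y = x | y \in A].
  by move/(subsetP XS); rewrite !inE => /or3P [/eqP|/eqP|]; [constructor 1|constructor 2|constructor 3].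
case/card_gt1P: X1 => y1 [y2 [y1X y2X y12]].
have [zX|zX] := boolP (z \in X); last first.
  have [uX xX] : u \in X /\ x \in X.
    case: (Xcases _ y1X) => [E|E|y1A]; first by rewrite E (negbTE zX) in y1X.
    - case: (Xcases _ y2X) => [E2|E2|y2A]; first by rewrite E2 (negbTE zX) in y2X.
        by rewrite E E2 eqxx in y12.
      by rewrite -(only_u y2) // -E.
    - case: (Xcases _ y2X) => [E2|E2|y2A]; first by rewrite E2 (negbTE zX) in y2X.
        by rewrite -(only_u y1) // -E2.
      by rewrite (small y1 y2) ?eqxx in y12.
  by move/eqP: zxu; apply; apply: U.
have [y [yX yz]] : exists y, y \in X /\ y != z.
  by case: (eqVneq y1 z) y12 => [->|?] y12; [exists y2 | exists y1]; rewrite // eq_sym.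
move/twinP: tx => tx.
case: (Xcases _ yX) => [E|E|yA]; first by rewrite E eqxx in yz.
- subst y; move/negP: ntz; apply; apply/twinP => w wA wu; rewrite -tx //.
  have wX : w \notin X by apply: contraNN wu => wX; rewrite (only_u w).
  by apply: negb_inj; rewrite -!flip //; apply: U => //; exact: memS.
- have [yu|yu] := eqVneq y u.
    subst y; move/negP: ntz; apply; apply/twinP => w wA wu.
    have wX : w \notin X by apply: contraNN wu => wX; rewrite (small w u).
    rewrite (e_total wu); apply: negb_inj; rewrite -flip // negbK.
    by apply: U => //; exact: memS.
  have uX : u \notin X by apply: contraNN yu => uX; rewrite (small y u).
  have xX : x \notin X by apply: contraNN yu => xX; rewrite (only_u y).
  have E1 : e u y = e u z by apply: U => //; exact: memS.
  have E2 : e x y = e x z by apply: U => //; rewrite !inE eqxx orbT.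
  have E3 : e x z = e u z by rewrite -E1 -E2 tx.
  by move: zxu; rewrite (e_total xz) E3 (flip u z) // negbK eqxx.
Qed.

Lemma prime_two_extension (C : {set T}) :
    prime_on e C -> 2 < #|C| -> C != [set: T] -> prime_on e [set: T] ->
    (forall v, v \notin C -> ~ prime_on e (v |: C)) ->
  exists x y, [/\ x \notin C, y \notin C, x != y & prime_on e (y |: (x |: C))].
Proof.
move=> PC C2 CV PV NE; apply: NNPP => N.
have [[x [u [xC uC tx]]]|H] :=
  classic (exists x u, [/\ x \notin C, u \in C & twin C x u]).
(* B collects u and all its twins outside C. It misses a vertex of C, so primality yields a vertex z
   outside B separating some twin w from u. No vertex of C does that, hence z is outside C and is
   not a twin of u: [twin_split_prime] applies to w and z. *)
- pose B := u |: [set w | (w \notin C) && twin C w u].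
  have [a [_ [aC _ au _ _]]] := two_others C2 uC.
  have EB : B = [set: T].
    apply: prime_trivial PV (subsetT _) _ _; last first.
      apply/card_gt1P; exists u, x; split; rewrite ?inE ?eqxx ?xC ?tx ?orbT //.
      by apply: contraNneq xC => <-.
    suff H z w : z \notin B -> w \in B -> e z w = e z u.
      by move=> z w1 w2 _ zB w1B w2B; rewrite (H z w1) ?(H z w2).
    rewrite !inE negb_or => /andP [zu zB].
    case/orP => [/eqP -> //|/andP [wC tw]]; have [zC|zC] := boolP (z \in C).
      have zw : w != z by apply: contraNneq wC => ->.
      rewrite (e_total zw) (twinP _ _ _ tw) // -e_total //.
      by rewrite eq_sym.
    rewrite zC /= in zB; apply/eqP/negPn/negP => D; apply: N.
    have wz : w != z by apply: contraNneq zB => <-.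
    by exists w, z; split=> //; exact: (@twin_split_prime C u).
  by have := in_setT a; rewrite -EB !inE (negbTE au) aC.
(* Without twins every outside vertex is constant on C, which makes C homogeneous in the whole
   tournament. *)
- move/eqP: CV; apply; apply: prime_trivial PV (subsetT _) _ _; last by lia.
  move=> z x y _ zC xC yC.
  have [[b Hb]|[u uC tu]] := prime_extension PC C2 zC (NE z zC).
    by rewrite !Hb.
  by case: H; exists z, u.
Qed.

(** * Critical tournaments and the vertices outside them *)

(* D is laid out along the path p 0, ..., p l.-1; W is empty for T_n and U_n, and
   holds the last vertex w_n of W_n. *)
Record critical (F : crit_type) (D : {set T}) (p : nat -> T) (l : nat) (W : {set T})
    : Prop := Critical {
  crit_inj : forall i j, i < l -> j < l -> p i = p j -> i = j;
  crit_mem : forall i, i < l -> p i \in D;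
  crit_cover : forall x, x \in D -> x \in W \/ exists2 i, i < l & x = p i;
  crit_sub : W \subset D;
  crit_out : forall i, i < l -> p i \notin W;
  crit_forward : forall i j, i < j -> j < l ->
    e (p i) (p j) = forward F (odd i) (odd j);
  crit_extra : forall i w, i < l -> w \in W -> e (p i) w = odd i;
  crit_shape : if F is FamW then ~~ odd l /\ #|W| = 1 else odd l /\ W = set0
}.

Lemma crit_backward F D p l W i j : critical F D p l W -> j < i -> i < l ->
  e (p i) (p j) = ~~ forward F (odd j) (odd i).
Proof.
move=> K ji il; rewrite -(crit_forward K ji il); apply: e_total.
by apply/eqP => /(crit_inj K (ltn_trans ji il) il); lia.
Qed.

Lemma crit_card F D p l W : critical F D p l W -> #|D| = l + #|W|.
Proof.
move=> K; have inj : injective (fun i : 'I_l => p i).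
  by move=> i j /(crit_inj K (ltn_ord i) (ltn_ord j)) /ord_inj.
have -> : D = [set p i | i : 'I_l] :|: W.
  apply/setP => x; rewrite !inE; apply/idP/orP => [/(crit_cover K) [xW|[i il ->]]|].
  - by right.
  - by left; apply/imsetP; exists (Ordinal il).
  - case=> [/imsetP [i _ ->]|]; first exact: crit_mem K _ (ltn_ord i).
    exact: (subsetP (crit_sub K)).
rewrite cardsU card_imset // card_ord.
suff -> : [set p i | i : 'I_l] :&: W = set0 by rewrite cards0 subn0.
apply/setP => x; rewrite !inE; apply/negbTE/andP => -[/imsetP [i _ ->]].
by apply/negP; exact: crit_out K _ (ltn_ord i).
Qed.

Lemma crit_skip F D p l W k : critical F D p l W -> k.+1 < l ->
  critical F (D :\ p k :\ p k.+1) (p \o skip k) l.-2 W.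
Proof.
move=> K kl; have lt i : i < l.-2 -> skip k i < l by exact: skip_lt.
have kl' : k < l by lia.
have inj := crit_inj K.
have nW (x : T) i : i < l -> x \in W -> x != p i.
  by move=> il xW; apply: contraTneq xW => ->; exact: crit_out K _ il.
split.
- move=> i j il jl /(inj _ _ (lt _ il) (lt _ jl)); rewrite /skip; case: ifP; case: ifP; lia.
- move=> i il /=; rewrite !inE (crit_mem K (lt _ il)) andbT.
  apply/andP; split; apply/eqP => /(inj _ _ (lt _ il)); rewrite /skip; case: ifP => ?; lia.
- move=> x; rewrite !inE => /and3P [x1 x0 /(crit_cover K) [xW|[i il E]]]; first by left.
  right; have i0 : i != k by apply: contraNneq x0 => <-; rewrite E.
  have i1 : i != k.+1 by apply: contraNneq x1 => <-; rewrite E.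
  exists (if i < k then i else i.-2); first by case: ifP; lia.
  rewrite E /= /skip; congr p; case: (ltnP i k) => Hi; first by rewrite Hi.
  by rewrite ifF; lia.
- apply/subsetP => x xW; rewrite !inE (subsetP (crit_sub K)) // andbT.
  by rewrite !nW.
- by move=> i il; exact: crit_out K _ (lt _ il).
- move=> i j ij jl; rewrite /= (crit_forward K) ?odd_skip ?lt //.
  by rewrite /skip; case: ifP; case: ifP; lia.
- by move=> i w il wW; rewrite /= (crit_extra K) ?odd_skip ?lt.
- by have := crit_shape K; case: (F) => -[? ?]; split=> //; lia.
Qed.

Lemma crit_sub_iso F D D' p l W g :
    critical F D p l W -> {in D &, injective g} -> g @: D = D' ->
    {in D &, forall u v, e u v = e (g u) (g v)} ->
  critical F D' (g \o p) l (g @: W).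
Proof.
move=> K gi gE ge; have pD := crit_mem K; have WD := subsetP (crit_sub K).
split.
- by move=> i j il jl /= /gi E; apply: (crit_inj K il jl); apply: E; apply: pD.
- by move=> i il; rewrite -gE /= imset_f // pD.
- move=> x; rewrite -gE => /imsetP [y /(crit_cover K) [yW|[i il ->]] ->].
    by left; rewrite imset_f.
  by right; exists i.
- by rewrite -gE imsetS // (crit_sub K).
- move=> i il; apply/imsetP => -[w wW /gi E].
  by have := crit_out K il; rewrite E ?wW ?pD ?WD.
- by move=> i j ij jl; rewrite /= -ge ?(crit_forward K) ?pD //; lia.
- by move=> i _ il /imsetP [w wW ->]; rewrite /= -ge ?(crit_extra K) ?pD ?WD.
- have := crit_shape K; case: (F) => -[H1 H2]; split=> //.
  + by rewrite H2 imset0.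
  + by rewrite H2 imset0.
  + by rewrite card_in_imset // => x y xW yW; apply: gi; exact: WD.
Qed.

(** The value at i = w carries no meaning. *)
Definition row (F : crit_type) (w i : nat) : bool :=
  if w < i then forward F (odd w) (odd i) else ~~ forward F (odd i) (odd w).

Lemma crit_row F D p l W w i : critical F D p l W ->
  w < l -> i < l -> i != w -> e (p w) (p i) = row F w i.
Proof.
move=> K wl il iw; rewrite /row; case: ltnP => H; first by apply: (crit_forward K).
by apply: (crit_backward K) => //; lia.
Qed.

(** The letter at w is arbitrary, because the edge between twins is; the rule must therefore hold on
    both pairs containing w for either value of that letter. *)
Lemma tame_row F l f (w : nat) :
  (forall i, i < l -> i != w -> f i = row F w i) -> tame F l f.
Proof.
move=> H.
have step (r : local_rule) : (forall i, i.+1 != w -> i != w ->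
      r (odd i) (row F w i) (row F w i.+1)) ->
    (forall i c, i.+1 = w -> r (odd i) (row F w i) c) ->
    (forall c, r (odd w) c (row F w w.+1)) -> obeys r l f.
  move=> H1 H2 H3; apply/obeysP => i il.
  have [E|iw] := eqVneq i w; first by subst w; rewrite (H i.+1) //; (exact: H3 || lia).
  have [E|iw1] := eqVneq i.+1 w; first by rewrite (H i) //; (exact: H2 || lia).
  by rewrite !H //; (exact: H1 || lia).
(* The rule is dictated by the type and, except in type W, by the parity of w. *)
have : has (fun r => obeys r l f) [:: if F is FamT then
    if odd w then twisted_rising else twisted_falling else
    if F is FamU then if odd w then rising else twisted_falling else rising].
  rewrite /= orbF; case: F step {H} => step; rewrite /rising /twisted_rising /twisted_falling;
  case ow : (odd w); apply: step => [i i1 i0|i c E|c]; rewrite /row /= ?ltnn ?ltnSn ?ow //=; try (by case: c);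
  try (by move: ow; rewrite -E ltnNge leqnSn /=; case: odd => //; case: c);
  case: ltnP => H1; case: ltnP => H2; try lia; by case: odd.
rewrite /tame; case: F {H step}; case: (odd w); rewrite /= ?orbF => ->; rewrite ?orbT //.
Qed.

Lemma crit_tame F D p l W v : critical F D p l W ->
    (exists b, forall x, x \in D -> e v x = b) \/ (exists2 u, u \in D & twin D v u) ->
  tame F l (fun i => e v (p i)).
Proof.
move=> K [[b Hb]|[u uD /twinP tw]].
  have E i : i < l -> e v (p i) = b by move=> /(crit_mem K); exact: Hb.
  suff: has (fun r => obeys r l (fun i => e v (p i))) [:: if F is FamT then steady else rising].
    by rewrite /tame; case: F {K} => /=; rewrite ?orbF => ->; rewrite ?orbT.
  rewrite /= orbF; apply/obeysP => i il; rewrite !E //; last by lia.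
  by case: F {K}; rewrite /steady /rising ?eqxx ?implybb.
have [uW|[w wl Eu]] := crit_cover K uD.
  have := crit_shape K; case: F K => K; try by case=> _ W0; rewrite W0 inE in uW.
  move=> _; rewrite /tame /= orbF; apply/orP; right; apply/obeysP => i il.
  (* A twin of the extra vertex has the alternating word demanded by [twisted_full]. *)
  have E j : j < l -> e v (p j) = ~~ odd j.
    move=> jl; have ju : p j != u by apply: contraNneq (crit_out K jl) => ->.
    by rewrite tw ?(crit_mem K) // (e_total ju) (crit_extra K).
  by rewrite /twisted_full (E _ il) (E _ (ltnW il)) /=; case: (odd i).
apply: (@tame_row _ _ _ w) => i il iw.
have pw : p i != u by rewrite Eu; apply: contra_neq iw; exact: (crit_inj K il wl).
by rewrite tw ?(crit_mem K) // Eu (crit_row K).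
Qed.

Lemma rising_threshold l f : obeys rising l f ->
  exists2 a, a <= l & forall i, i < l -> f i = (a <= i).
Proof.
elim: l => [|l IH] /obeysP H; first by exists 0.
have [|a al Ha] := IH; first by apply/obeysP => i il; apply: H; lia.
have [E|al'] := eqVneq a l.
  case fl : (f l).
    exists l => // i; rewrite ltnS leq_eqVlt => /orP [/eqP ->|il]; first by rewrite fl leqnn.
    by rewrite Ha // E.
  exists l.+1 => // i; rewrite ltnS leq_eqVlt => /orP [/eqP ->|il]; first by rewrite fl ltnn.
  by rewrite Ha // E; lia.
exists a; first lia.
move=> i; rewrite ltnS leq_eqVlt => /orP [/eqP ->|]; last exact: Ha.
have l0 : l.-1.+1 = l by lia.
have := H l.-1; rewrite l0 ltnSn => /(_ isT); rewrite /rising Ha; last by lia.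
have -> : a <= l.-1 by lia.
by rewrite al /= => ->.
Qed.

Lemma twisted_rising_threshold l f : obeys twisted_rising l f ->
  exists2 a, a <= l & forall i, i < l -> f i = (a <= i) (+) odd i.
Proof.
move=> /obeysP H; have [|a al Ha] := @rising_threshold l (fun i => f i (+) odd i).
  by apply/obeysP => i /H.
by exists a => // i il; rewrite -Ha // addbK.
Qed.

Lemma twisted_falling_threshold l f : obeys twisted_falling l f ->
  exists2 a, a <= l & forall i, i < l -> f i = (i < a) (+) odd i.
Proof.
move=> /obeysP H; have [|a al Ha] := @rising_threshold l (fun i => ~~ (f i (+) odd i)).
  apply/obeysP => i /H; rewrite /twisted_falling /rising /=.
  by case: (f i); case: (f i.+1); case: odd.
by exists a => // i il; rewrite ltnNge -Ha // negbK addbK.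
Qed.

Lemma steady_constant l f : obeys steady l f ->
  forall i, i < l -> f i = f 0.
Proof.
move=> /obeysP H; elim=> // i IH il; rewrite -IH; last by lia.
by have /eqP := H i il.
Qed.

Lemma row_twin F D p l W v w : critical F D p l W -> w < l ->
    (forall i, i < l -> i != w -> e v (p i) = row F w i) ->
    (forall x, x \in W -> e v x = odd w) ->
  exists2 u, u \in D & twin D v u.
Proof.
move=> K wl H HW; exists (p w); first exact: (crit_mem K).
apply/twinP => x /(crit_cover K) [xW|[i il ->]] xu; first by rewrite HW // (crit_extra K).
have iw : i != w by apply: contra_neq xu => ->.
by rewrite H // (crit_row K).
Qed.

(** Converse of [crit_tame]. Since the letter at w is free, the row of w has threshold w or w + 1;
    so a word with threshold a is compared with positions a and a - 1, and parity decides between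
    them. *)
Lemma tame_extension F D p l W v : critical F D p l W -> v \notin D ->
    tame F l (fun i => e v (p i)) ->
  (exists b, forall x, x \in D -> e v x = b) \/ (exists2 u, u \in D & twin D v u).
Proof.
move=> K vD; have shape := crit_shape K.
have const b : (forall i, i < l -> e v (p i) = b) -> (forall x, x \in W -> e v x = b) ->
    exists b, forall x, x \in D -> e v x = b.
  by move=> H HW; exists b => x /(crit_cover K) [|[i il ->]]; [exact: HW | exact: H].
have noW b : F <> FamW -> forall x, x \in W -> e v x = b.
  by case: F shape {K} => // -[_ ->] _ x; rewrite inE.
have rowE w i : row F w i = if w < i then forward F (odd w) (odd i) else ~~ forward F (odd i) (odd w) by [].
rewrite /tame; case: F K shape noW rowE => K shape noW rowE /=; rewrite orbF.
- case: shape => lodd _; case/or3P.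
  + case/twisted_rising_threshold => a al Ha; right.
    (* The extreme words a = 0 and a = l are rows of the opposite ends of the path, [l.-1] and 0: in
       T_n the path closes up. *)
    case oa : (odd a); last first.
      have [a0|a0] := posnP a; [apply: (row_twin (w := l.-1) K); try lia; try exact: noW|
        apply: (row_twin (w := a.-1) K); try lia; try exact: noW] =>
      i il iw; rewrite Ha // rowE /=; case: ifP => ?; lia.
    have [a0|a0] := eqVneq a l; [apply: (row_twin (w := 0) K); try lia; try exact: noW|
        apply: (row_twin (w := a) K); try lia; try exact: noW] =>
      i il iw; rewrite Ha // rowE /=; case: ifP => ?; lia.
  + case/twisted_falling_threshold => a al Ha; right.
    case oa : (odd a); [apply: (row_twin (w := a.-1) K); try lia; try exact: noW|
        apply: (row_twin (w := a) K); try lia; try exact: noW] =>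
      i il iw; rewrite Ha // rowE /=; case: ifP => ?; lia.
  + move/steady_constant => H; left; apply: (const (e v (p 0))); first exact: H.
    exact: noW.
- case: shape => lodd _; case/orP.
  + case/rising_threshold => a al Ha.
    have [a0|a0] := posnP a.
      left; apply: (const true); last exact: noW.
      by move=> i il; rewrite Ha // a0.
    have [a1|a1] := eqVneq a l.
      left; apply: (const false); last exact: noW.
      by move=> i il; rewrite Ha // a1; lia.
    right; case oa : (odd a); [apply: (row_twin (w := a) K); try lia; try exact: noW|
        apply: (row_twin (w := a.-1) K); try lia; try exact: noW] =>
      i il iw; rewrite Ha // rowE /=; case: ifP => ?; lia.
  + case/twisted_falling_threshold => a al Ha; right.
    case oa : (odd a); [apply: (row_twin (w := a.-1) K); try lia; try exact: noW|
        apply: (row_twin (w := a) K); try lia; try exact: noW] =>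
      i il iw; rewrite Ha // rowE /=; case: ifP => ?; lia.
- case: shape => leven /eqP /cards1P [w0 EW].
  have inW x : x \in W -> x = w0 by rewrite EW => /set1P.
  case/orP.
  + case/rising_threshold => a al Ha.
    (* The edge from v to the extra vertex prescribes the parity of w, and the threshold leaves a or
       a - 1. When the candidate of the right parity falls off the path, v is constant. *)
    have rowT w : w < l -> odd w = e v w0 -> (a = w) \/ (a = w.+1) ->
        exists2 u, u \in D & twin D v u.
      move=> wl ow aw; apply: (row_twin K wl); last by move=> x /inW ->.
      by move=> i il iw; rewrite Ha // rowE /=; case: ifP => ?; lia.
    have [E|E] := eqVneq (odd a) (e v w0); first have [a1|a1] := eqVneq a l.
    * left; apply: (const false) => [i il|x /inW ->]; first by rewrite Ha // a1; lia.
      by rewrite -E a1; apply: negbTE.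
    * by right; apply: (rowT a) => //; [lia | left].
    * have [a0|a0] := posnP a.
        left; apply: (const true) => [i il|x /inW ->]; first by rewrite Ha // a0.
        by move: E; rewrite a0; case: (e v w0).
      right; apply: (rowT a.-1); [lia | | right; lia].
      by move: E; case: (e v w0) => /=; lia.
  + move=> /obeysP H; right.
    have g i : i < l -> e v (p i) = ~~ odd i.
      move=> il; have [il1|il1] := ltnP i.+1 l.
        by have /andP [] := H _ il1; case: (odd i); case: (e v (p i)).
      have i1 : i.-1.+1 = i by lia.
      have := H i.-1; rewrite i1 il => /(_ isT) /andP [_].
      by rewrite -[in odd i]i1 /=; case: (odd i.-1); case: (e v (p i)).
    exists w0; first by apply: (subsetP (crit_sub K)); rewrite EW set11.
    apply/twinP => x /(crit_cover K) [/inW ->|[i il ->]] xw; first by rewrite eqxx in xw.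
    by rewrite g // (e_total xw) (crit_extra K) // EW set11.
Qed.

(** The word of v is wild by [tame_extension] and stays wild after a suitable deletion; by
    [crit_tame], v is then neither constant nor a twin on what remains. *)
Lemma crit_prime_extension F D p l W v :
    critical F D p l W -> 6 < #|D| -> v \notin D -> prime_on e (v |: D) ->
  exists2 k, k.+1 < l & prime_on e (D :\ p k :\ p k.+1) ->
    prime_on e (v |: (D :\ p k :\ p k.+1)).
Proof.
move=> K D6 vD P; have cD := crit_card K.
have wild : ~~ tame F l (fun i => e v (p i)).
  apply/negP => /(tame_extension K vD) [[b Hb]|[u uD tu]]; move: P.
    by apply: constant_not_prime Hb => //; lia.
  by apply: twin_not_prime tu => //; lia.
(* |D| is l in types T and U and l + 1 in type W, so |D| > 6 gives the lengths asked by
   [wild_skip]. *)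
have lF : (if F is FamW then 6 else 7) <= l.
  by have := crit_shape K; case: (F) => -[_ E]; rewrite E ?cards0 in cD; lia.
have [k kl wk] := wild_skip lF wild.
have Kk := crit_skip K kl.
exists k => // PA; apply: NNPP => NP; case/negP: wk.
apply: (crit_tame Kk); apply: prime_extension => //.
  by rewrite (crit_card Kk); case: (F) lF; lia.
by rewrite !inE (negbTE vD) !andbF.
Qed.

(** * The removal graph of a rigid subtournament *)

Definition rigid (C : {set T}) : Prop :=
  forall (Z : {set T}) v, sub_iso e Z C -> v \notin Z -> ~ prime_on e (v |: Z).

Section RemovalGraph.

Variables C D : {set T}.
Hypotheses (PC : prime_on e C) (C4 : 4 < #|C|) (RC : rigid C).
Hypothesis PD : prime_on e D.

Definition edge (p q : T) : Prop :=
  [/\ p \in D, q \in D, p != q & sub_iso e (D :\ p :\ q) C].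

Lemma edge_sym p q : edge p q -> edge q p.
Proof. by case=> pD qD pq I; split; rewrite // 1?eq_sym // setDDl setUC -setDDl. Qed.

Lemma edge_card p q : edge p q -> #|D :\ p :\ q| = #|C|.
Proof. by case=> _ _ _; exact: sub_iso_card. Qed.

Lemma edge_prime p q : edge p q -> prime_on e (D :\ p :\ q).
Proof. by case=> _ _ _ I; apply: prime_sub_iso PC; exact: sub_iso_inverse. Qed.

(** D - p arises by adding q to a copy of C, so rigidity prevents it from being prime. *)
Lemma edge_cases p q : edge p q ->
  (exists b, forall x, x \in D :\ p :\ q -> e q x = b) \/
  (exists2 r, r \in D :\ p :\ q & twin (D :\ p :\ q) q r).
Proof.
move=> Epq; have [pD qD pq I] := Epq.
have qA : q \notin D :\ p :\ q by rewrite !inE eqxx.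
apply: prime_extension => //; first exact: edge_prime.
  by rewrite (edge_card Epq); lia.
exact: RC.
Qed.

(** If q is a twin of r on D - p - q, replacing r by q there gives D - p - r, another copy of C. *)
Lemma edge_next p q : edge p q ->
  (exists2 r, r != q & edge p r) \/
  (exists b, forall x, x \in D -> x != p -> x != q -> e q x = b).
Proof.
move=> Epq; have [pD qD pq I] := Epq.
case: (edge_cases Epq) => [[b Hb]|[r rA tr]].
  by right; exists b => x xD xp xq; apply: Hb; rewrite !inE xp xq.
left; move: (rA); rewrite !inE => /and3P [rq rp rD]; exists r => //.
split; rewrite // 1?eq_sym //; apply: sub_iso_trans I; apply: sub_iso_inverse.
apply: (twin_exchange rA _ tr); first by rewrite !inE eqxx.
apply/setP => z; rewrite !inE; have [->|//] := eqVneq z q.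
by rewrite eq_sym rq qD eq_sym pq.
Qed.

Lemma edge_card_rest p q r : edge p r -> q \in D -> q != p -> q != r ->
  q |: (D :\ p :\ r :\ q) = D :\ p :\ r /\ 1 < #|D :\ p :\ r :\ q|.
Proof.
move=> Epr qD qp qr; have qA : q \in D :\ p :\ r by rewrite !inE qr qp.
split; first exact: setD1K.
by have := edge_card Epr; rewrite (cardsD1 q) qA; lia.
Qed.

(** Were q constant, or a twin of some u other than r, on D - p - q, it would remain so on D - p - q
    - r, and the copy D - p - r of C would not be prime. *)
Lemma edge_twin p q r : edge p q -> edge p r -> q != r -> twin (D :\ p :\ q) q r.
Proof.
move=> Epq Epr qr; have [pD qD pq _] := Epq; have [_ rD pr _] := Epr.
have qp : q != p by rewrite eq_sym.
have [E card1] := edge_card_rest Epr qD qp qr.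
have P := edge_prime Epr; rewrite -E in P.
have qB : q \notin D :\ p :\ r :\ q by rewrite !inE eqxx.
have sub x : x \in D :\ p :\ r :\ q -> x \in D :\ p :\ q.
  by rewrite !inE => /and4P [-> _ -> ->].
case: (edge_cases Epq) => [[b Hb]|[u uA tu]].
  by case: (@constant_not_prime _ q b card1 qB _ P) => x /sub; exact: Hb.
have [<- //|ur] := eqVneq u r.
case: (@twin_not_prime _ q u card1 qB _ _ P).
  by move: uA; rewrite !inE ur => /and3P [-> -> ->].
by apply/twinP => x /sub xA xu; apply: (twinP _ _ _ tu).
Qed.

Lemma edge_twin_eq p q r z : edge p q -> edge p r -> q != r -> z \in D ->
  z != p -> z != q -> z != r -> e z q = e z r.
Proof.
move=> Epq Epr qr zD zp zq zr; rewrite eq_sym in zq; rewrite eq_sym in zr.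
rewrite (e_total zq) (e_total zr); congr (~~ _).
apply: (twinP _ _ _ (edge_twin Epq Epr qr)); last by rewrite eq_sym.
by rewrite !inE zD zp eq_sym zq.
Qed.

(** Otherwise {q, r} would be homogeneous in D, as p is the only vertex that can separate the
    two. *)
Lemma edge_split p q r : edge p q -> edge p r -> q != r -> e p r = ~~ e p q.
Proof.
move=> Epq Epr qr; have [pD qD pq _] := Epq; have [_ rD pr _] := Epr.
apply/eqP/negPn/negP => H.
have {}H : e p q = e p r by move: H; case: (e p q); case: (e p r).
have E : [set q; r] = D.
  apply: prime_trivial PD _ _ _; last by rewrite cards2 qr.
    by apply/subsetP => x; rewrite !inE => /orP [] /eqP ->.
  move=> z x y zD; rewrite !inE negb_or => /andP [zq zr].
  have Ez : e z q = e z r.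
    by have [->|zp] := eqVneq z p; rewrite // (edge_twin_eq Epq Epr).
  by do 2 case/orP => /eqP ->; rewrite ?Ez.
by move: pD; rewrite -E !inE (negbTE pq) (negbTE pr).
Qed.

(** The twins q and r would both lie in D - p - s, which is prime. *)
Lemma edge_degree p q r s : edge p q -> edge p r -> edge p s ->
  q != r -> q != s -> r != s -> False.
Proof.
move=> Epq Epr Eps qr qs rs; have [pD qD pq _] := Epq; have [_ rD pr _] := Epr.
have qp : q != p by rewrite eq_sym.
have [E card1] := edge_card_rest Eps qD qp qs.
have P := edge_prime Eps; rewrite -E in P.
apply: (@twin_not_prime _ q r card1 _ _ _ P).
- by rewrite !inE eqxx.
- by rewrite !inE rs rD eq_sym qr eq_sym pr.
- apply/twinP => x; rewrite !inE => /and4P [xq xs xp xD] xr.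
  by apply: (twinP _ _ _ (edge_twin Epq Epr qr)); rewrite // !inE xq xp.
Qed.

(** * Longest paths of the removal graph and the shape of D *)

Definition is_path (p : nat -> T) (l : nat) : Prop :=
  (forall i j, i < l -> j < l -> p i = p j -> i = j) /\
  (forall i, i.+1 < l -> edge (p i) (p i.+1)).

Lemma path_size p l : is_path p l -> l <= #|T|.
Proof.
case=> inj _; rewrite -[l]card_ord; apply: (leq_card (fun i : 'I_l => p i)).
by move=> i j /(inj _ _ (ltn_ord i) (ltn_ord j)) /ord_inj.
Qed.

Lemma path_rev p l : is_path p l -> is_path (fun i => p (l.-1 - i)) l.
Proof.
case=> inj Ep; split=> [i j il jl /inj|i il]; first by lia.
have -> : l.-1 - i = (l.-1 - i.+1).+1 by lia.
by apply/edge_sym/Ep; lia.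
Qed.

Definition maximal_path p l : Prop :=
  [/\ is_path p l, 1 < l & forall p' l', is_path p' l' -> l' <= l].

Lemma maximal_path_exists x y : edge x y -> exists p l, maximal_path p l.
Proof.
move=> Exy.
have grow n : forall l p, 1 < l -> is_path p l -> #|T| - l < n ->
    exists p l, maximal_path p l.
  elim: n => // n IH l p l2 Pp nl.
  have [H|N] := classic (forall p' l', is_path p' l' -> l' <= l); first by exists p, l.
  have [p' N'] := not_all_ex_not _ _ N; have [l' N''] := not_all_ex_not _ _ N'.
  have [Pp' /negP] := imply_to_and _ _ N''; rewrite -ltnNge => ll'.
  by have lT := path_size Pp'; apply: (IH l' p') => //; lia.
apply: (grow _ 2 (fun i => if i is 0 then x else y) _ _ (ltnSn _)) => //.
have [_ _ xy _] := Exy; split; last by case.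
by do 2 case=> [|[|?]] //; move=> _ _ E; rewrite E eqxx in xy.
Qed.

Lemma maximal_path_rev p l :
  maximal_path p l -> maximal_path (fun i => p (l.-1 - i)) l.
Proof. by case=> P l2 M; split=> //; exact: path_rev. Qed.

(** A second neighbour of [p 0] lies on the path by maximality; at an interior position it would
    have degree three, so it is the other end. *)
Lemma maximal_path_end p l : maximal_path p l ->
  (exists b, forall x, x \in D -> x != p 0 -> x != p 1 -> e (p 1) x = b) \/
  (2 < l /\ edge (p l.-1) (p 0)).
Proof.
case=> -[inj Ep] l2 M; have E01 := Ep 0 l2.
case: (edge_next E01) => [[r r1 Er]|]; last by left.
right; have [_ _ r0 _] := Er.
have [[j jl rj]|out] := classic (exists2 j, j < l & r = p j); last first.
  have : is_path (fun i => if i is j.+1 then p j else r) l.+1.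
    split; last by case=> [|i] il; [exact: edge_sym | exact: Ep].
    move=> [|i] [|j] // il jl E; last by rewrite (inj i j).
    - by case: out; exists j.
    - by case: out; exists i.
  by move/M; rewrite ltnn.
have j0 : j != 0 by apply: contraNneq r0 => E; rewrite rj E.
have j1 : j != 1 by apply: contraNneq r1 => E; rewrite rj E.
suff E : j = l.-1 by rewrite -E -rj; split; [lia | exact: edge_sym].
apply/eqP/negPn/negP => jl1.
have neq i k : i < l -> k < l -> i != k -> p i != p k.
  by move=> il kl; apply: contra_neq; exact: inj.
have jj : j.-1.+1 = j by lia.
rewrite rj in Er; apply: (@edge_degree (p j) (p 0) (p j.-1) (p j.+1)).
- exact: edge_sym.
- by rewrite -{1}jj; apply/edge_sym/Ep; lia.
- by apply: Ep; lia.
- by apply: neq; lia.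
- by apply: neq; lia.
- by apply: neq; lia.
Qed.

Definition off_path (p : nat -> T) (l : nat) : {set T} :=
  [set z in D | [forall i : 'I_l, z != p i]].

Section Path.

Variables (p : nat -> T) (l : nat).
Hypotheses (Pp : is_path p l) (l2 : 1 < l).

Lemma path_mem i : i < l -> p i \in D.
Proof.
case: Pp => _ Ep il; have [il1|il1] := ltnP i.+1 l; first by case: (Ep i il1).
have [i' E] : exists i', i = i'.+1 by exists i.-1; lia.
by rewrite E in il *; case: (Ep i' il).
Qed.

Lemma path_neq i j : i < l -> j < l -> i != j -> p i != p j.
Proof. by move=> il jl; apply: contra_neq; apply: Pp.1. Qed.

Lemma path_step z i : i.+2 < l -> z \in D -> z != p i -> z != p i.+1 ->
  z != p i.+2 -> e z (p i.+2) = e z (p i).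
Proof.
move=> il zD z0 z1 z2; apply: (@edge_twin_eq (p i.+1)) => //.
- by apply: Pp.2.
- by apply/edge_sym/Pp.2; lia.
- by apply: path_neq; lia.
Qed.

Lemma path_switch i : i.+2 < l -> e (p i.+1) (p i.+2) = ~~ e (p i.+1) (p i).
Proof.
move=> il; apply: edge_split; last by apply: path_neq; lia.
- by apply/edge_sym/Pp.2; lia.
- exact: Pp.2.
Qed.

(** The position i descends by twos and never meets j. Together with [path_right] this leaves only a
    few edges near the start to be determined. *)
Lemma path_left i j : i < j -> j < l -> e (p i) (p j) = e (p (odd i)) (p j).
Proof.
elim/ltn_ind: i => -[|[|i]] // IH ij jl.
have N k : k <= i.+2 -> p j != p k by move=> ki; apply: path_neq; lia.
rewrite e_total ?N // (path_step (i := i)) ?N ?path_mem //; try lia.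
rewrite -e_total; last by apply: N; lia.
by rewrite (IH i) /= ?negbK //; lia.
Qed.

Lemma path_right i j j' : i < j -> j <= j' -> j' < l -> odd j = odd j' ->
  e (p i) (p j) = e (p i) (p j').
Proof.
move=> ij; elim/ltn_ind: j' => j' IH jj jl oj.
have [-> //|jn] := eqVneq j j'.
have [k E] : exists k, j' = k.+2 by exists j'.-2; lia.
rewrite E in IH jj jl oj jn *.
rewrite (IH k) //; [|lia|lia|by rewrite oj /= negbK].
by rewrite path_step // ?path_mem //; try apply: path_neq; lia.
Qed.

Lemma off_pathP z : reflect (z \in D /\ forall i, i < l -> z != p i) (z \in off_path p l).
Proof.
rewrite inE; apply: (iffP andP) => -[zD H]; split=> //.
  by move=> i il; have /forallP /(_ (Ordinal il)) := H.
by apply/forallP => i; exact: H.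
Qed.

Lemma off_path_parity z i : z \in off_path p l -> i < l ->
  e z (p i) = e z (p (odd i)).
Proof.
case/off_pathP => zD zp; elim/ltn_ind: i => -[|[|i]] // IH il.
by rewrite path_step ?zp //; [rewrite (IH i) /= ?negbK //; lia | lia | lia].
Qed.

Lemma path_critical F :
    (forall i j, i < j -> j < l -> e (p i) (p j) = forward F (odd i) (odd j)) ->
    (forall i w, i < l -> w \in off_path p l -> e (p i) w = odd i) ->
    (if F is FamW then ~~ odd l /\ #|off_path p l| = 1
     else odd l /\ off_path p l = set0) ->
  critical F D p l (off_path p l).
Proof.
move=> Hf He Hs; split=> //.
- exact: Pp.1.
- exact: path_mem.
- move=> x xD; have [[i il E]|H] := classic (exists2 i, i < l & x = p i).
    by right; exists i.
  left; apply/off_pathP; split=> // i il.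
  by apply/eqP => E; apply: H; exists i.
- by apply/subsetP => x /off_pathP [].
- by move=> i il; apply/negP => /off_pathP [_ /(_ i il)]; rewrite eqxx.
Qed.

Lemma not_constant v b : v \in D -> 1 < #|D :\ v| ->
  (forall x, x \in D -> x != v -> e v x = b) -> False.
Proof.
move=> vD D1 H.
apply: (@constant_not_prime (D :\ v) v b D1); rewrite ?setD1K ?inE ?eqxx //.
by move=> x; rewrite !inE => /andP [xv xD]; exact: H.
Qed.

Lemma path_start_size : 4 < #|D :\ p 0 :\ p 1|.
Proof. by rewrite (edge_card (Pp.2 _ l2)). Qed.

(** Otherwise [p 1] would be constant on all other vertices of D. *)
Lemma path_start_switch b :
    (forall x, x \in D -> x != p 0 -> x != p 1 -> e (p 1) x = b) ->
  e (p 1) (p 0) = ~~ b.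
Proof.
move=> H; apply/eqP/negPn/negP => N.
have {}N : e (p 1) (p 0) = b by move: N; case: b {H}; case: (e _ _).
apply: (@not_constant (p 1) b); first by apply: path_mem; lia.
  have /subset_leq_card : D :\ p 0 :\ p 1 \subset D :\ p 1 by rewrite setSD // subsetDl.
  by have := path_start_size; lia.
move=> x xD x1; have [-> //|x0] := eqVneq x (p 0); exact: H.
Qed.

End Path.

Definition constant_off (v u : T) (b : bool) : Prop :=
  forall x, x \in D -> x != u -> x != v -> e v x = b.

Lemma open_path_ends p l b b' : is_path p l -> 1 < l ->
    constant_off (p 1) (p 0) b -> constant_off (p l.-2) (p l.-1) b' ->
  3 < l /\ b' = ~~ b.
Proof.
move=> Pp l2 H0 H1; have big := path_start_size Pp l2.
have mem := path_mem Pp l2; have ne := path_neq Pp.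
have l4 : 3 < l.
  have : l <> 2 /\ l <> 3; last by lia.
  split=> E; rewrite E in H1 mem ne.
  (* Case l = 2: both path vertices are constant on the remaining ones, which are thus
     homogeneous. *)
  - have X : D :\ p 0 :\ p 1 = D.
      apply: prime_trivial PD _ _ _; last by lia.
        by apply/subsetP => x; rewrite !inE => /and3P [].
      move=> z x y zD; rewrite !inE zD andbT negb_and !negbK => zX.
      move=> /and3P [x1 x0 xD] /and3P [y1 y0 yD].
      by case/orP: zX => /eqP ->; rewrite ?H0 ?H1.
    by have := mem 0 isT; rewrite -X !inE eqxx andbF.
  (* Case l = 3: [p 1] is constant off [p 0] and also off [p 2]; a further vertex x forces b = b',
     and the edge to [p 0] contradicts [path_start_switch]. *)
  - have [x] : exists x, x \in D :\ p 0 :\ p 1 :\ p 2.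
      by apply/card_gt0P; rewrite (cardsD1 (p 2)) in big; lia.
    rewrite !inE => /and4P [x2 x1 x0 xD].
    have := H0 x xD x0 x1; rewrite (H1 x xD x2 x1) => Eb.
    have := path_start_switch Pp l2 H0.
    by rewrite H1 ?mem ?ne // Eb; case: (b).
(* The edge between [p 1] and [p l.-2] is read from both ends. *)
split=> //; have N : p 1 != p l.-2 by apply: ne; lia.
rewrite -(H1 (p 1)); try (by apply: mem; lia); try (by apply: ne; lia).
by rewrite (e_total N) H0; [|apply: mem|apply: ne|rewrite eq_sym]; try lia.
Qed.

Lemma open_path_critical p l : is_path p l -> 1 < l ->
    constant_off (p 1) (p 0) true -> constant_off (p l.-2) (p l.-1) false ->
  exists F, critical F D p l (off_path p l).
Proof.
move=> Pp l2 H0 H1; have big := path_start_size Pp l2.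
have mem := path_mem Pp l2; have ne := path_neq Pp.
have [l4 _] := open_path_ends Pp l2 H0 H1.
have E10 := path_start_switch Pp l2 H0.
have E01 : e (p 0) (p 1).
  have N : p 1 != p 0 by apply: ne; lia.
  by rewrite (e_total N) E10.
have F1 j : 1 < j -> j < l -> e (p 1) (p j).
  by move=> j1 jl; apply: H0; rewrite ?mem ?ne //; lia.
have F01 j : j < l -> odd j -> e (p 0) (p j).
  by move=> jl oj; rewrite -(path_right Pp l2 (j := 1)) //; lia.
have F00 j : 0 < j -> j < l -> ~~ odd j -> e (p 0) (p j) = e (p 0) (p 2).
  by move=> j0 jl oj; rewrite -(path_right Pp l2 (j := 2)) //; lia.
have O1 z : z \in off_path p l -> e (p 1) z.
  by case/off_pathP => zD zp; apply: H0 => //; apply: zp; lia.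
have Oodd z i : z \in off_path p l -> i < l -> odd i -> e (p i) z.
  move=> zO il oi; have [_ zp] := off_pathP _ _ _ zO.
  rewrite (e_total (zp i il)) (off_path_parity Pp l2 zO il) oi /=.
  by rewrite -(e_total (zp 1 l2)) O1.
have Oend z : z \in off_path p l -> e (p l.-2) z = false.
  by case/off_pathP => zD zp; apply: H1 => //; apply: zp; lia.
have Oeven z i : ~~ odd l -> z \in off_path p l -> i < l -> ~~ odd i -> e (p i) z = false.
  move=> ol zO il oi; have [_ zp] := off_pathP _ _ _ zO.
  have l22 : l.-2 < l by lia.
  have oo : odd i = odd l.-2 by lia.
  rewrite (e_total (zp i il)) (off_path_parity Pp l2 zO il) oo.
  by rewrite -(off_path_parity Pp l2 zO l22) -(e_total (zp _ l22)) Oend.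
(* If the path covers D, an edge from [p 0] to [p 2] would make [p 0] dominate all of D. *)
have full : off_path p l = set0 -> ~~ e (p 0) (p 2).
  move=> O; apply/negP => E02; apply: (@not_constant (p 0) true); first by apply: mem; lia.
    by have : D :\ p 0 :\ p 1 \subset D :\ p 0; [exact: subsetDl | move/subset_leq_card; lia].
  move=> x xD x0; have [[i il Ei]|H] := classic (exists2 i, i < l & x = p i).
    have i0 : 0 < i by rewrite lt0n; apply: contraNneq x0 => E; rewrite Ei E.
    rewrite Ei; case oi : (odd i); first exact: F01.
    by rewrite F00 ?oi.
  suff : x \in off_path p l by rewrite O inE.
  by apply/off_pathP; split=> // i il; apply/eqP => E; apply: H; exists i.
case ol : (odd l).
(* For odd l, positions 1 and [l.-2] have the same parity, so a vertex off the path would have to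
   see them alike, against the two constants. *)
- have O : off_path p l = set0.
    apply/eqP/set0Pn => -[z zO]; have := Oend z zO.
    by rewrite Oodd //; lia.
  exists FamU; apply: path_critical => //; last by move=> i w _; rewrite O inE.
  move=> i j ij jl; rewrite (path_left Pp l2 ij jl) /=.
  case oi : (odd i) => /=; first by rewrite F1 //; lia.
  case oj : (odd j); first exact: F01.
  by rewrite F00 ?oj ?(negbTE (full O)) //; lia.
(* For even l, slide 2 to [l.-2], whose vertex is dominated by [p 0]. *)
- have E02 : e (p 0) (p 2).
    rewrite -(F00 l.-2); [|lia|lia|lia].
    have N : p l.-2 != p 0 by apply: ne; lia.
    by rewrite (e_total N) H1 ?mem ?ne //; lia.
  exists FamW; apply: path_critical => //.
  + move=> i j ij jl; rewrite (path_left Pp l2 ij jl) /=.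
    case oi : (odd i) => /=; first by rewrite F1 //; lia.
    case oj : (odd j); first exact: F01.
    by rewrite F00 ?oj //; lia.
  + move=> i z il zO; case oi : (odd i); first exact: Oodd.
    by rewrite Oeven ?ol ?oi.
  + rewrite ol; split=> //; apply/eqP; rewrite eqn_leq; apply/andP; split; last first.
      rewrite card_gt0; apply/negP => /eqP O.
      by have := full O; rewrite E02.
    (* Each path vertex treats all vertices off the path alike, so these form a homogeneous set. *)
    rewrite leqNgt; apply/negP => O1lt.
    have O : off_path p l = D.
      apply: prime_trivial PD _ _ O1lt; first by apply/subsetP => x /off_pathP [].
      move=> z x y zD zO xO yO.
      have [[i il Ei]|H] := classic (exists2 i, i < l & z = p i); last first.
        case/negP: zO; apply/off_pathP; split=> // i il.
        by apply/eqP => E; apply: H; exists i.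
      rewrite Ei; case oi : (odd i); first by rewrite !Oodd.
      by rewrite !Oeven ?ol ?oi.
    have : p 0 \in off_path p l by rewrite O mem //; lia.
    by case/off_pathP => _ /(_ 0); rewrite eqxx; move/(_ (ltnW l2)).
Qed.

(** The closing edge makes [p 1] and [p l.-1] the two neighbours of [p 0]. For even l they have
    equal parity, contradicting [edge_split]. For odd l the two parity classes are linked, so a
    vertex off the path sees the whole path alike, and the path is homogeneous. *)
Lemma cycle_forward p l : is_path p l -> 2 < l -> edge (p l.-1) (p 0) ->
  [/\ odd l, off_path p l = set0 & forall i j, i < j -> j < l ->
    e (p i) (p j) = (odd i (+) odd j == e (p 0) (p 1))].
Proof.
move=> Pp l3 E; have l2 := ltnW l3.
have mem := path_mem Pp l2; have ne := path_neq Pp.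
have last_prev : edge (p l.-1) (p l.-2).
  have -> : l.-1 = l.-2.+1 by lia.
  by apply/edge_sym/Pp.2; lia.
have S0 : e (p 0) (p l.-1) = ~~ e (p 0) (p 1).
  by apply: edge_split; [exact: Pp.2 | exact: edge_sym | apply: ne; lia].
have ol : odd l.
  apply/negPn/negP => ol; move: S0.
  rewrite -(path_right Pp l2 (j := 1)); [|lia|lia|lia|by rewrite /=; lia].
  by case: (e _ _).
have same w k : w \in off_path p l -> k < l -> e w (p k) = e w (p 0).
  move=> wO kl; have [wD wp] := off_pathP _ _ _ wO.
  have l1 : l.-1 < l by lia.
  have := off_path_parity Pp l2 wO l1; have -> : odd l.-1 = false by lia.
  have -> : e w (p l.-1) = e w (p 1).
    apply: (@edge_twin_eq (p 0)) => //; try by apply: wp; lia.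
    - exact: edge_sym.
    - exact: Pp.2.
    - by apply: ne; lia.
  by move=> w01; rewrite (off_path_parity Pp l2 wO kl); case: (odd k).
have on w : w \in D :\: off_path p l -> exists2 i, i < l & w = p i.
  rewrite inE => /andP [wO wD]; apply: NNPP => N; case/negP: wO.
  by apply/off_pathP; split=> // i il; apply/eqP => Ew; apply: N; exists i.
have pon i : i < l -> p i \in D :\: off_path p l.
  move=> il; rewrite inE mem // andbT; apply/negP => /off_pathP [_ /(_ i il)].
  by rewrite eqxx.
have X : D :\: off_path p l = D.
  apply: prime_trivial PD (subsetDl _ _) _ _.
    move=> w x y wD; rewrite inE wD andbT negbK => wO /on [i il ->] /on [j jl ->].
    by rewrite !(same w).
  apply/card_gt1P; exists (p 0), (p 1); split; [apply: pon | apply: pon | apply: ne]; lia.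
have O : off_path p l = set0.
  apply/eqP/set0Pn => -[z zO]; have [zD _] := off_pathP _ _ _ zO.
  by move: zD; rewrite -X inE zO.
split=> // i j ij jl; rewrite (path_left Pp l2 ij jl).
have S1 : e (p 1) (p 2) = e (p 0) (p 1).
  have N : p 1 != p 0 by apply: ne; lia.
  by rewrite (e_total N); apply: (@path_switch p l).
case oi : (odd i); case oj : (odd j) => /=.
(* Slide to [l.-2], then pass to [p 0]: both are neighbours of [p l.-1]. *)
- rewrite (path_right Pp l2 (j' := l.-2)); [|lia|lia|lia|lia].
  rewrite (_ : e (p 1) (p l.-2) = e (p 1) (p 0)).
    have N : p 0 != p 1 by apply: ne; lia.
    by rewrite (e_total N); case: (e _ _).
  apply: (@edge_twin_eq (p l.-1)); [exact: last_prev | exact: E | apply: ne | apply: mem |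
    apply: ne | apply: ne | apply: ne]; lia.
- rewrite -(path_right Pp l2 (j := 2)); [|lia|lia|lia|lia].
  by rewrite S1; case: (e _ _).
- rewrite -(path_right Pp l2 (j := 1)); [|lia|lia|lia|lia].
  by case: (e _ _).
- rewrite (path_right Pp l2 (j' := l.-1)); [|lia|lia|lia|lia].
  by rewrite S0; case: (e _ _).
Qed.

Lemma removal_critical x y : edge x y ->
  exists F p l, is_path p l /\ critical F D p l (off_path p l).
Proof.
case/maximal_path_exists => p [l M]; have [Pp l2 _] := M.
have M' := maximal_path_rev M; have [Pp' _ _] := M'.
have cycle : 2 < l -> edge (p l.-1) (p 0) ->
    exists F p l, is_path p l /\ critical F D p l (off_path p l).
  move=> l3 E; have [ol O fw] := cycle_forward Pp l3 E.
  have [_ O' fw'] : [/\ odd l, off_path (fun i => p (l.-1 - i)) l = set0 &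
      forall i j, i < j -> j < l -> e (p (l.-1 - i)) (p (l.-1 - j)) =
        (odd i (+) odd j == e (p (l.-1 - 0)) (p (l.-1 - 1)))].
    by apply: (cycle_forward Pp' l3); rewrite subnn subn0; exact: edge_sym.
  (* Type T asks for a forward edge from position 0 to 1; failing that, the reversed path has
     one. *)
  case b : (e (p 0) (p 1)).
  - exists FamT, p, l; split=> //; apply: path_critical => //.
    + by move=> i j ij jl; rewrite fw // b eqb_id.
    + by move=> i w _; rewrite O inE.
  - exists FamT, (fun i => p (l.-1 - i)), l; split=> //; apply: path_critical => //.
    + have b' : e (p (l.-1 - 0)) (p (l.-1 - 1)).
        have N : p (l.-1 - 1) != p (l.-1 - 0) by apply: (path_neq Pp); lia.
        by rewrite (e_total N) fw; [rewrite b; lia | lia | lia].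
      by move=> i j ij jl; rewrite fw' // b' eqb_id.
    + by move=> i w _; rewrite O' inE.
case: (maximal_path_end M) => [[b H0]|[l3]]; last exact: cycle.
case: (maximal_path_end M') => [[b' H1]|[l3]]; last first.
  by rewrite subnn subn0 => /edge_sym; exact: cycle.
have {}H1 : constant_off (p l.-2) (p l.-1) b'.
  by move=> z zD z0 z1; rewrite -(H1 z) ?subn0 ?subn1.
have [l4 bb] := open_path_ends Pp l2 H0 H1.
(* The ends have opposite constants, so one of the two directions starts with [true]. *)
case: b H0 bb => H0 /= bb; rewrite bb in H1.
  have [F K] := open_path_critical Pp l2 H0 H1.
  by exists F, p, l.
have [||F K] := @open_path_critical (fun i => p (l.-1 - i)) l Pp' l2.
- by rewrite subn0 subn1.
- by rewrite subnn; have -> : l.-1 - l.-2 = 1 by lia.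
- by exists F, (fun i => p (l.-1 - i)), l.
Qed.

End RemovalGraph.

(** * Rigidity passes from C to D *)

Lemma sub_iso_remove (D Z : {set T}) (g : T -> T) a b :
    {in D &, injective g} -> g @: D = Z ->
    {in D &, forall u v, e u v = e (g u) (g v)} -> a \in D -> b \in D ->
  sub_iso e (D :\ a :\ b) (Z :\ g a :\ g b).
Proof.
move=> gi gE ge aD bD.
have sub x : x \in D :\ a :\ b -> x \in D by rewrite !inE => /and3P [].
exists g; split; last split.
- by move=> x y /sub xD /sub yD; exact: gi.
- apply/setP => z; apply/imsetP/idP => [[x]|].
    rewrite !inE => /and3P [xb xa xD] ->; rewrite -gE imset_f // andbT.
    by apply/andP; split; [apply: contra_neq xb | apply: contra_neq xa] => /gi; exact.
  rewrite !inE -gE => /and3P [zb za /imsetP [x xD E]].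
  exists x => //; rewrite !inE xD andbT.
  by apply/andP; split; [apply: contraNneq zb | apply: contraNneq za] => <-; rewrite E.
- by move=> x y /sub xD /sub yD; exact: ge.
Qed.

(** The layout of D is carried to its copy Z. If v extended Z to a prime set, [crit_prime_extension]
    would make v extend Z minus a consecutive pair, which is a copy of C. *)
Lemma critical_rigid (C D : {set T}) F p l W :
    prime_on e C -> rigid C -> 6 < #|D| -> critical F D p l W ->
    (forall k, k.+1 < l -> sub_iso e (D :\ p k :\ p k.+1) C) ->
  rigid D.
Proof.
move=> PC RC D6 K HC Z v I vZ PvZ.
have [g [gi [gE ge]]] := sub_iso_inverse I.
have KZ := crit_sub_iso K gi gE ge.
rewrite -(sub_iso_card I) in D6.
have [k kl Hk] := crit_prime_extension KZ D6 vZ PvZ.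
have IC : sub_iso e (Z :\ g (p k) :\ g (p k.+1)) C.
  apply: sub_iso_trans (HC k kl); apply: sub_iso_inverse.
  by apply: sub_iso_remove => //; apply: (crit_mem K); lia.
apply: (RC _ v IC); first by rewrite !inE (negbTE vZ) !andbF.
by apply: Hk; apply: prime_sub_iso PC; exact: sub_iso_inverse.
Qed.

Lemma rigid_critical C : prime_on e [set: T] -> prime_on e C -> 4 < #|C| ->
  rigid C -> C != [set: T] -> exists F p l W, critical F [set: T] p l W.
Proof.
move=> PT; have [n] := ubnP (#|T| - #|C|).
elim: n C => // n IH C nC PC C4 RC CT.
have C2 : 2 < #|C| by lia.
have NE v : v \notin C -> ~ prime_on e (v |: C) by apply: RC; exact: sub_iso_refl.
have [x [y [xC yC xy PD]]] := prime_two_extension PC C2 CT PT NE.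
set D := y |: (x |: C) in PD.
have yxC : y \notin x |: C by rewrite !inE negb_or eq_sym xy.
have cD : #|D| = #|C|.+2 by rewrite cardsU1 yxC cardsU1 xC.
have Exy : edge C D x y.
  split; rewrite ?inE ?eqxx ?orbT //.
  by rewrite setDDl setUC -setDDl !setU1K //; exact: sub_iso_refl.
have [F [p [l [Pp K]]]] := removal_critical PC C4 RC PD Exy.
have [E|DT] := eqVneq D [set: T]; first by exists F, p, l, (off_path D p l); rewrite -E.
have D_le : #|D| <= #|T| by exact: max_card.
apply: (IH D) => //; try lia.
apply: (critical_rigid PC RC _ K); first by lia.
by move=> k kl; case: (Pp.2 k kl).
Qed.

(** * Identification with T_n, U_n and W_n *)

Lemma tiso_intro n (r : rel 'I_n) (h : 'I_n -> T) : #|T| = n -> injective h ->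
  (forall i j, e (h i) (h j) = r i j) -> tiso e r.
Proof.
move=> cT hi he; have [|g hK gK] := inj_card_bij hi; first by rewrite cT card_ord.
exists g; split; first by exists h.
by move=> u v; rewrite -he !gK.
Qed.

Lemma cyclic_distance n i j : i < n -> j < n ->
  (j + n - i) %% n = if i <= j then j - i else j + n - i.
Proof.
move=> il jl; case: leqP => ij; last by rewrite modn_small //; lia.
have -> : j + n - i = j - i + n by lia.
by rewrite modnDr modn_small //; lia.
Qed.

(* Position in the path of the vertex with index [m] in T_n or U_n: the even
   positions 2k, ..., 2, 0 become k, ..., 2k, the odd ones 2k-1, ..., 1 become
   0, ..., k-1. *)
Definition path_index (k m : nat) : nat :=
  if m < k then (k.-1 - m).*2.+1 else (k.*2 - m).*2.

Lemma critical_tiso_T p l W : critical FamT [set: T] p l W ->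
  tiso e (@Tn_rel (l./2).*2.+1).
Proof.
move=> K; have [ol W0] := crit_shape K.
have cT := crit_card K; rewrite W0 cards0 addn0 cardsT in cT.
move: (l./2) (odd_double_half l) => k; rewrite ol add1n => E.
have lt (i : 'I_(k.*2.+1)) : path_index k i < l.
  by have := ltn_ord i; rewrite /path_index; case: ifP; lia.
apply: (tiso_intro (h := fun i => p (path_index k i))); first by rewrite cT.
- move=> i j /(crit_inj K (lt i) (lt j)) H; apply: val_inj => /=; move: H.
  by have := ltn_ord i; have := ltn_ord j; rewrite /path_index; do 2 case: ifP; lia.
- move=> i j; rewrite /Tn_rel cyclic_distance //.
  have [H|H|H] := ltngtP (path_index k i) (path_index k j).
  + rewrite (crit_forward K) //=; move: H.
    by have := ltn_ord i; have := ltn_ord j; rewrite /path_index; do 3 case: ifP; lia.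
  + rewrite (crit_backward K) //=; move: H.
    by have := ltn_ord i; have := ltn_ord j; rewrite /path_index; do 3 case: ifP; lia.
  + rewrite H e_irr; move: H.
    by have := ltn_ord i; have := ltn_ord j; rewrite /path_index; do 3 case: ifP; lia.
Qed.

Lemma critical_tiso_U p l W : critical FamU [set: T] p l W ->
  tiso e (@Un_rel (l./2).*2.+1).
Proof.
move=> K; have [ol W0] := crit_shape K.
have cT := crit_card K; rewrite W0 cards0 addn0 cardsT in cT.
move: (l./2) (odd_double_half l) => k; rewrite ol add1n => E.
have lt (i : 'I_(k.*2.+1)) : path_index k i < l.
  by have := ltn_ord i; rewrite /path_index; case: ifP; lia.
apply: (tiso_intro (h := fun i => p (path_index k i))); first by rewrite cT.
- move=> i j /(crit_inj K (lt i) (lt j)) H; apply: val_inj => /=; move: H.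
  by have := ltn_ord i; have := ltn_ord j; rewrite /path_index; do 2 case: ifP; lia.
- move=> i j; rewrite /Un_rel /Tn_rel !cyclic_distance //.
  have -> : (k.*2.+1)./2 = k by lia.
  have [H|H|H] := ltngtP (path_index k i) (path_index k j).
  + rewrite (crit_forward K) //=; move: H.
    by have := ltn_ord i; have := ltn_ord j; rewrite /path_index; do 4 case: ifP; lia.
  + rewrite (crit_backward K) //=; move: H.
    by have := ltn_ord i; have := ltn_ord j; rewrite /path_index; do 4 case: ifP; lia.
  + rewrite H e_irr; move: H.
    by have := ltn_ord i; have := ltn_ord j; rewrite /path_index; do 4 case: ifP; lia.
Qed.

(** The path is the transitive part in its order and the extra vertex is w_n. Position i is w_{i+1},
    so odd positions are the even subscripts that dominate w_n. *)
Lemma critical_tiso_W p l W : critical FamW [set: T] p l W ->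
  tiso e (@Wn_rel (l./2).*2.+1).
Proof.
move=> K; have [ol /eqP /cards1P [w EW]] := crit_shape K.
have cT := crit_card K; rewrite EW cards1 addn1 cardsT in cT.
have wW : w \in W by rewrite EW set11.
move: (l./2) (odd_double_half l) => k; rewrite (negbTE ol) add0n => E; subst l.
have ne i : i < k.*2 -> p i != w by move=> il; apply: contraTneq wW => <-; exact: (crit_out K).
apply: (tiso_intro (h := fun i : 'I_(k.*2.+1) => if i < k.*2 then p i else w)).
- exact: cT.
- move=> i j; have := ltn_ord i; have := ltn_ord j.
  case: ifP => il; case: ifP => jl _ _ H; apply: val_inj => /=.
  + exact: (crit_inj K).
  + by have := ne i il; rewrite H eqxx.
  + by have := ne j jl; rewrite H eqxx.
  + by have := ltn_ord i; have := ltn_ord j; lia.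
- move=> i j; rewrite /Wn_rel /=; have := ltn_ord i; have := ltn_ord j.
  case: ifP => il; case: ifP => jl /= jn iN.
  + have [H|H|H] := ltngtP i j.
    * by rewrite (crit_forward K).
    * by rewrite (crit_backward K).
    * by rewrite H e_irr.
  + by rewrite (crit_extra K) // ifT //; lia.
  + by rewrite (e_total (ne j jl)) (crit_extra K) // ifF ?ifT //; lia.
  + by rewrite e_irr ifT //; lia.
Qed.

End Tournament.

Theorem theorem3p1 (T : finType) (e : rel T)
  (HG : is_tournament e)
  (HGprime : prime_on e [set: T])
  (HnotT : forall k : nat, ~ tiso e (@Tn_rel k.*2.+1))
  (HnotU : forall k : nat, ~ tiso e (@Un_rel k.*2.+1))
  (HnotW : forall k : nat, ~ tiso e (@Wn_rel k.*2.+1))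
  (S : {set T})
  (HSprime : prime_on e S)
  (HS5 : 5 <= #|S|)
  (HSle : #|S| <= #|T| - 1) :
  exists S' : {set T},
    #|S'| = #|S| + 1 /\ prime_on e S' /\
    exists S'' : {set T}, S'' \subset S' /\ sub_iso e S'' S.
Proof.
case: HG => _ [irr tot].
have e_irr u : e u u = false by apply: negbTE.
have e_total u v : u != v -> e v u = ~~ e u v.
  by move/tot; case: (e u v); case: (e v u).
(* Negating the conclusion makes S rigid: a prime [v |: Z] with Z a copy of S is exactly what is
   sought. *)
apply: NNPP => N.
have rigidS : rigid e S.
  move=> Z v I vZ P; apply: N; exists (v |: Z); split; last split=> //.
    by rewrite cardsU1 vZ (sub_iso_card I) addnC.
  by exists Z; split=> //; exact: subsetUr.
have ST : S != [set: T] by apply/eqP => E; rewrite E cardsT in HSle HS5; lia.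
have [F [p [l [W K]]]] := rigid_critical e_irr e_total HGprime HSprime HS5 rigidS ST.
case: F K => K.
- exact: HnotT (critical_tiso_T e_irr e_total K).
- exact: HnotU (critical_tiso_U e_irr e_total K).
- exact: HnotW (critical_tiso_W e_irr e_total K).
Qed.
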